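(* Let a pHDAE in block form $$E\dot x=(J-R)Qx+Bu,\qquad y=B^TQx$$ be given, with state $x=[x_1^T\ x_2^T\ x_3^T]^T$, $x_i\in\mathbb R^{n_i}$, $n=n_1+n_2+n_3$, structured as described in the context. Let $r<n_1$ (in applications $r\ll n_1$), let $\hat V\in\mathbb R^{n_1\times n_1}$ be invertible with $\hat V^{-1}x_1=[x_{1,r}^T\ x_{1,s}^T]^T$, $x_{1,r}\in\mathbb R^r$, $x_{1,s}\in\mathbb R^{n_1-r}$, and use the notation for the blocks of the correspondingly transformed system given in the context. Then the reduced model obtained by the Effort Constraint Reduction Method (ECRM), with reduced state $x^{\mathrm{ec}}=[x_{1,r}^T\ x_2^T\ x_3^T]^T\in\mathbb R^{r+n_2+n_3}$, is the system $$E^{\mathrm{ec}}\dot x^{\mathrm{ec}}=(J^{\mathrm{ec}}-R^{\mathrm{ec}})\,Q^{\mathrm{ec}}x^{\mathrm{ec}}+B^{\mathrm{ec}}u,\qquad y^{\mathrm{ec}}=(B^{\mathrm{ec}})^TQ^{\mathrm{ec}}x^{\mathrm{ec}},$$ with $$E^{\mathrm{ec}}=\begin{bmatrix}I_r&0&0\\ 0&I_{n_2}&0\\ 0&0&0\end{bmatrix},\quad J^{\mathrm{ec}}=\begin{bmatrix}J_{11}^{rr}&J_{12}^r&J_{13}^r\\ J_{21}^r&J_{22}&J_{23}\\ J_{31}^r&J_{32}&J_{33}\end{bmatrix},\quad R^{\mathrm{ec}}=\begin{bmatrix}R_{11}^{rr}&R_{12}^r&R_{13}^r\\ R_{21}^r&R_{22}&R_{23}\\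 R_{31}^r&R_{32}&R_{33}\end{bmatrix},$$ $$Q^{\mathrm{ec}}=\begin{bmatrix}\hat Q_{11}&0&0\\ 0&0&0\\ \hat Q_{31}&Q_{32}&Q_{33}\end{bmatrix},\quad B^{\mathrm{ec}}=\begin{bmatrix}B_1^r\\ B_2\\ B_3\end{bmatrix},$$ where $\hat Q_{11}=Q_{11}^{rr}-Q_{11}^{rs}(Q_{11}^{ss})^{-1}(Q_{11}^{rs})^T$ and $\hat Q_{31}=Q_{31}^r-Q_{31}^s(Q_{11}^{ss})^{-1}(Q_{11}^{rs})^T$. This reduced model is a pHDAE, with $J^{\mathrm{ec}}=-(J^{\mathrm{ec}})^T$ and $R^{\mathrm{ec}}=(R^{\mathrm{ec}})^T\ge 0$.
   Context: **pHDAE.** A system $E\dot x=(J-R)Qx+(B-P)u$, $y=(B+P)^TQx+(S+N)u$ with real matrices $E,Q,J,R\in\mathbb R^{n\times n}$, $B,P\in\mathbb R^{n\times m}$, $S=S^T,N=-N^T\in\mathbb R^{m\times m}$ is called a port-Hamiltonian differential-algebraic system (pHDAE) if: (1) $Q^TJ^TQ=-Q^TJQ$ and $Q^TE=E^TQ$; (2) $Q^TE=E^TQ\ge0$ (positive semidefinite); (3) the passivity matrix $W=\begin{bmatrix}Q^TRQ&Q^TP\\ P^TQ&S\end{bmatrix}$ satisfies $W=W^T\ge0$. When $P=S=N=0$, condition (3) says $Q^TRQ=Q^TR^TQ\ge 0$. **Block form of the full system.** Here $P=S=N=0$, and with respect to $\mathbb R^n=\mathbb R^{n_1}\times\mathbb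 R^{n_2}\times\mathbb R^{n_3}$, $$E=\begin{bmatrix}I_{n_1}&0&0\\ 0&I_{n_2}&0\\ 0&0&0\end{bmatrix},\quad Q=\begin{bmatrix}Q_{11}&0&0\\ 0&0&0\\ Q_{31}&Q_{32}&Q_{33}\end{bmatrix},\quad J=[J_{ij}],\quad R=[R_{ij}],\quad B=\begin{bmatrix}B_1\\ B_2\\ B_3\end{bmatrix}\in\mathbb R^{n\times m},$$ with $J=-J^T$, $R=R^T\ge0$, $J_{j3}-R_{j3}=0$ for $j=1,2$, $Q_{11}=Q_{11}^T>0$ and $Q_{33}$ nonsingular. **Transformed system.** Put $V=\mathrm{diag}(\hat V,I_{n_2},I_{n_3})$. The transformed system has state $[x_{1,r}^T\ x_{1,s}^T\ x_2^T\ x_3^T]^T=V^{-1}x$ and matrices $V^{-1}EV=E$, $V^{-1}JV^{-T}$, $V^{-1}RV^{-T}$, $V^TQV$, $V^{-1}B$. Their blocks with respect to the partition $(x_{1,r},x_{1,s},x_2,x_3)$ are denoted $$V^{-1}JV^{-T}=\begin{bmatrix}J_{11}^{rr}&J_{11}^{rs}&J_{12}^r&J_{13}^r\\ J_{11}^{sr}&J_{11}^{ss}&J_{12}^s&J_{13}^s\\ J_{21}^r&J_{21}^s&J_{22}&J_{23}\\ J_{31}^r&J_{31}^s&J_{32}&J_{33}\end{bmatrix},\quad V^TQV=\begin{bmatrix}Q_{11}^{rr}&Q_{11}^{rs}&0&0\\ (Q_{11}^{rs})^T&Q_{11}^{ss}&0&0\\ 0&0&0&0\\ Q_{31}^r&Q_{31}^s&Q_{32}&Q_{33}\end{bmatrix},\quad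 V^{-1}B=\begin{bmatrix}B_1^r\\ B_1^s\\ B_2\\ B_3\end{bmatrix},$$ and $V^{-1}RV^{-T}$ is partitioned and denoted like $V^{-1}JV^{-T}$. **Port representation.** Write $V^{-1}RV^{-T}=C\hat RC^T$ with $0<\hat R=\hat R^T\in\mathbb R^{\ell\times\ell}$ and $C\in\mathbb R^{n\times\ell}$ with orthonormal columns (from an ordered Schur decomposition). With flows $f_x=-(V^{-1}EV)V^{-1}x'$ (where $x'=\dot x$), efforts $e_x=(V^TQV)V^{-1}x$, $e_R=C^Te_x$, $f_R=-\hat Re_R$, the transformed system is equivalent to $$-f_x=(V^{-1}JV^{-T})e_x+Cf_R+V^{-1}Bu,\qquad 0=-(V^{-1}B)^Te_x+y,\qquad 0=-C^Te_x+e_R,$$ where $f_x$, $e_x$ are partitioned as $(x_{1,r},x_{1,s},x_2,x_3)$. **ECRM.** The reduced model by ECRM is obtained by: imposing $e_{x_{1,s}}=0$ in these equations (equivalently $x_{1,s}=-(Q_{11}^{ss})^{-1}(Q_{11}^{rs})^Tx_{1,r}$); deleting the block row containing $f_{x_{1,s}}$ (i.e. multiplying from the left by a matrix of maximal rank annihilating the coefficient of $f_{x_{1,s}}$); inserting the constitutive relations for the remaining flows $f_{x_{1,r}}=-\dot x_{1,r}$, $f_{x_2}=-\dot x_2$, $f_{x_3}=0$ and for the remaining efforts (with $x_{1,s}$ replaced by the expression above); and eliminating $f_R,e_R$ through $f_R=-\hat Re_R$ (closing the resistive port). The resulting output is denoted $y^{\mathrm{ec}}$. *)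

(* Defs.v *)
From HB Require Import structures.
From mathcomp Require Import all_boot all_order all_algebra.
From mathcomp Require Import all_classical all_reals all_analysis.

Set Implicit Arguments.
Unset Strict Implicit.
Unset Printing Implicit Defensive.

Import Order.TTheory GRing.Theory Num.Theory.
Import numFieldNormedType.Exports.
Local Open Scope ring_scope.

Definition psd (K : realType) n (A : 'M[K]_n) : Prop :=
  A^T = A /\ forall v : 'cV[K]_n, 0 <= (v^T *m A *m v) 0 0.

Definition posdef (K : realType) n (A : 'M[K]_n) : Prop :=
  A^T = A /\ forall v : 'cV[K]_n, v != 0 -> 0 < (v^T *m A *m v) 0 0.

(* Entrywise derivative of a vector-valued curve; unlike the derivative in the
   normed module of matrices it makes sense in dimension 0 as well.           *)
Definition vderivable (K : realType) n (x : K -> 'cV[K]_n) (t : K) : Prop :=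
  forall i, derivable (fun s : K => x s i 0 : K) t 1.

Definition vderiv (K : realType) n (x : K -> 'cV[K]_n) (t : K) : 'cV[K]_n :=
  \col_i derive1 (fun s : K => x s i 0 : K) t.

(* The data of  E x' = (J - R) Q x + (B - P) u,
                y = (B + P)^T Q x + (S + N) u.                                *)
Record phsys (K : realType) (n m : nat) := PHSys {
  mxE : 'M[K]_n; mxJ : 'M[K]_n; mxR : 'M[K]_n; mxQ : 'M[K]_n;
  mxB : 'M[K]_(n, m); mxP : 'M[K]_(n, m);
  mxS : 'M[K]_m; mxN : 'M[K]_m }.

Definition phsys_at (K : realType) n m (Sg : phsys K n m)
    (x : K -> 'cV[K]_n) (u y : K -> 'cV[K]_m) (t : K) : Prop :=
  mxE Sg *m vderiv x t
    = (mxJ Sg - mxR Sg) *m mxQ Sg *m x t + (mxB Sg - mxP Sg) *m u t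
  /\ y t = (mxB Sg + mxP Sg)^T *m mxQ Sg *m x t + (mxS Sg + mxN Sg) *m u t.

Definition passivity_mx (K : realType) n m (Sg : phsys K n m) : 'M[K]_(n + m) :=
  block_mx ((mxQ Sg)^T *m mxR Sg *m mxQ Sg) ((mxQ Sg)^T *m mxP Sg)
           ((mxP Sg)^T *m mxQ Sg)           (mxS Sg).

Definition is_pHDAE (K : realType) n m (Sg : phsys K n m) : Prop :=
  [/\ (mxS Sg)^T = mxS Sg /\ (mxN Sg)^T = - mxN Sg,
      (mxQ Sg)^T *m (mxJ Sg)^T *m mxQ Sg = - ((mxQ Sg)^T *m mxJ Sg *m mxQ Sg),
      (mxQ Sg)^T *m mxE Sg = (mxE Sg)^T *m mxQ Sg,
      psd ((mxQ Sg)^T *m mxE Sg)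
    & psd (passivity_mx Sg)].

Definition phsys0 (K : realType) n m (E J R Q : 'M[K]_n) (B : 'M[K]_(n, m)) :
  phsys K n m := PHSys E J R Q B 0 0 0.

Definition block3 (K : realType) a1 a2 a3 b1 b2 b3
    (A11 : 'M[K]_(a1, b1)) (A12 : 'M[K]_(a1, b2)) (A13 : 'M[K]_(a1, b3))
    (A21 : 'M[K]_(a2, b1)) (A22 : 'M[K]_(a2, b2)) (A23 : 'M[K]_(a2, b3))
    (A31 : 'M[K]_(a3, b1)) (A32 : 'M[K]_(a3, b2)) (A33 : 'M[K]_(a3, b3)) :
  'M[K]_(a1 + a2 + a3, b1 + b2 + b3) :=
  block_mx (block_mx A11 A12 A21 A22) (col_mx A13 A23) (row_mx A31 A32) A33.

Definition col3 (K : realType) a1 a2 a3 b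
    (B1 : 'M[K]_(a1, b)) (B2 : 'M[K]_(a2, b)) (B3 : 'M[K]_(a3, b)) :
  'M[K]_(a1 + a2 + a3, b) := col_mx (col_mx B1 B2) B3.

(* Embeddings of the index blocks: i1, i2, i3 for R^n1 x R^n2 x R^n3, and
   ir, is_ for the splitting of the first block when n1 = r + s.  The block of
   A in block row a and block column b is then  mxsub a b A.                  *)
Definition i1 n1 n2 n3 (i : 'I_n1) : 'I_(n1 + n2 + n3) := lshift n3 (lshift n2 i).
Definition i2 n1 n2 n3 (i : 'I_n2) : 'I_(n1 + n2 + n3) := lshift n3 (rshift n1 i).
Definition i3 n1 n2 n3 (i : 'I_n3) : 'I_(n1 + n2 + n3) := rshift (n1 + n2) i.
Definition ir r s n2 n3 (i : 'I_r) : 'I_(r + s + n2 + n3) := i1 n2 n3 (lshift s i).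
Definition is_ r s n2 n3 (i : 'I_s) : 'I_(r + s + n2 + n3) := i1 n2 n3 (rshift r i).
Arguments i1 {n1 n2 n3} i.
Arguments i2 {n1 n2 n3} i.
Arguments i3 {n1 n2 n3} i.
Arguments ir {r s n2 n3} i.
Arguments is_ {r s n2 n3} i.

Definition Eblk (K : realType) n1 n2 n3 : 'M[K]_(n1 + n2 + n3) :=
  block3 1%:M 0    0
         0    1%:M 0
         0    0    0.

Definition Qblk (K : realType) n1 n2 n3 (Q11 : 'M[K]_n1) (Q31 : 'M[K]_(n3, n1))
    (Q32 : 'M[K]_(n3, n2)) (Q33 : 'M[K]_n3) : 'M[K]_(n1 + n2 + n3) :=
  block3 Q11 0   0
         0   0   0
         Q31 Q32 Q33.

Definition Vblk (K : realType) n1 n2 n3 (Vhat : 'M[K]_n1) : 'M[K]_(n1 + n2 + n3) :=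
  block3 Vhat 0    0
         0    1%:M 0
         0    0    1%:M.

(* Change of state x = V z in a system with P = S = N = 0, where in addition the
   state equation is multiplied by V^-1 from the left.                        *)
Definition transform (K : realType) n m (V : 'M[K]_n) (Sg : phsys K n m) :
  phsys K n m :=
  phsys0 (invmx V *m mxE Sg *m V)
         (invmx V *m mxJ Sg *m (invmx V)^T)
         (invmx V *m mxR Sg *m (invmx V)^T)
         (V^T *m mxQ Sg *m V)
         (invmx V *m mxB Sg).

Section ECRM.
Context (K : realType) (r s n2 n3 m : nat).
Local Notation N := (r + s + n2 + n3)%N.

(* Full row rank matrix annihilating the coefficient of f_{x_{1,s}}: left
   multiplication by it deletes the block row of x_{1,s}.                     *)
Definition delete_s : 'M[K]_(r + n2 + n3, N) :=
  block3 (row_mx 1%:M 0) 0    0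
         0               1%:M 0
         0               0    1%:M.

(* The equations of the reduced model at time t, for a transformed system Sg
   with P = S = N = 0 and resistive part C Rhat C^T.  In this order: the port
   representation with the block row of x_{1,s} deleted; the effort constraint
   e_{x_{1,s}} = 0; the flow and effort relations; the closed resistive port.
   The flows fx, fR, the efforts ex, eR and the neglected state xs are the
   eliminated variables.  The x_{1,s} block of fx stays unconstrained, since
   its equation has been deleted.                                             *)
Definition ecrm_at l (Sg : phsys K N m) (C : 'M[K]_(N, l)) (Rhat : 'M[K]_l)
    (xr : K -> 'cV[K]_r) (x2 : K -> 'cV[K]_n2) (x3 : K -> 'cV[K]_n3)
    (u y : K -> 'cV[K]_m) (t : K) : Prop :=
  exists (fx ex : 'cV[K]_N) (fR eR : 'cV[K]_l) (xs : 'cV[K]_s),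
    [/\ delete_s *m (- fx)
          = delete_s *m (mxJ Sg *m ex + C *m fR + mxB Sg *m u t),
        0 = - ((mxB Sg)^T *m ex) + y t
      & 0 = - (C^T *m ex) + eR]
    /\ rowsub is_ ex = 0
    /\ [/\ rowsub ir fx = - vderiv xr t,
           rowsub i2 fx = - vderiv x2 t,
           rowsub i3 fx = 0,
           ex = mxQ Sg *m col3 (col_mx (xr t) xs) (x2 t) (x3 t)
         & fR = - (Rhat *m eR)].

Definition Qss_inv (Qt : 'M[K]_N) : 'M[K]_s := invmx (mxsub is_ is_ Qt).

Definition Qhat11 (Qt : 'M[K]_N) : 'M[K]_r :=
  mxsub ir ir Qt - mxsub ir is_ Qt *m Qss_inv Qt *m (mxsub ir is_ Qt)^T.

Definition Qhat31 (Qt : 'M[K]_N) : 'M[K]_(n3, r) :=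
  mxsub i3 ir Qt - mxsub i3 is_ Qt *m Qss_inv Qt *m (mxsub ir is_ Qt)^T.

Definition ec_block (A : 'M[K]_N) : 'M[K]_(r + n2 + n3) :=
  block3 (mxsub ir ir A) (mxsub ir i2 A) (mxsub ir i3 A)
         (mxsub i2 ir A) (mxsub i2 i2 A) (mxsub i2 i3 A)
         (mxsub i3 ir A) (mxsub i3 i2 A) (mxsub i3 i3 A).

Definition ec_system (Sg : phsys K N m) : phsys K (r + n2 + n3) m :=
  phsys0 (Eblk K r n2 n3)
         (ec_block (mxJ Sg))
         (ec_block (mxR Sg))
         (Qblk (Qhat11 (mxQ Sg)) (Qhat31 (mxQ Sg))
               (mxsub i3 i2 (mxQ Sg)) (mxsub i3 i3 (mxQ Sg)))
         (col3 (rowsub ir (mxB Sg)) (rowsub i2 (mxB Sg)) (rowsub i3 (mxB Sg))).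

End ECRM.

(* Main.v *)
Require Import Defs.
From mathcomp Require Import all_boot all_order all_algebra.
From mathcomp Require Import all_classical all_reals all_analysis.

(** Two matrices carry the proof.  Let [D := delete_s] select the rows kept by
    the reduction, and let [T := constrain_s L], with
    [L = - Qss^-1 Qrs^T], send a reduced state [(x_r, x_2, x_3)] to the full
    state whose neglected part is [x_s = L x_r], the only one with zero effort
    [e_s].  Since the efforts on the range of [T] vanish in the block row [s],
    the selection [D] loses nothing there, and

        Q T = D^T Qec   ([mul_Q_constrain]),   D E T = Eec.

    The port equations without their block row [s], evaluated at
    [e_x = Q T z = D^T Qec z], then read

        Eec z' = (D J D^T - D R D^T) Qec z + D B u,   y = (D B)^T Qec z,

    and [D J D^T], [D R D^T], [D B] are the coefficients with the block row and
    column [s] removed, so that this is the claimed system ([ecrm_atP]).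

    The structure is inherited through congruences.  [D J D^T] is skew and
    [D R D^T] is positive semidefinite because [J] and [R] are so, and
    [Qec^T Eec = Qec^T D E T = T^T (Q^T E) T] is positive semidefinite because
    [Q^T E] is ([is_pHDAE_ec]); its leading block is the Schur complement
    [Qhat11].  The change of basis [V] acts by congruences as well, and
    preserves the shape of [E] and [Q] ([transform_E], [transform_Q]).  The
    inverse of [Qss] exists because [Qss] is a principal block of the positive
    definite matrix [Vhat^T Q11 Vhat]. *)

Set Implicit Arguments.
Unset Strict Implicit.
Unset Printing Implicit Defensive.

Import Order.TTheory GRing.Theory Num.Theory.
Local Open Scope ring_scope.

(** * Definite matrices *)

Section Definite.
Context (K : realType).

Lemma psd_congr n p (A : 'M[K]_n) (T : 'M[K]_(n, p)) :
  psd A -> psd (T^T *m A *m T).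
Proof.
move=> [symA geA]; split; first by rewrite !trmx_mul trmxK symA mulmxA.
by move=> v; have := geA (T *m v); rewrite trmx_mul !mulmxA.
Qed.

Lemma posdef_congr n p (A : 'M[K]_n) (T : 'M[K]_(n, p)) :
  (forall v : 'cV_p, T *m v = 0 -> v = 0) ->
  posdef A -> posdef (T^T *m A *m T).
Proof.
move=> injT [symA gtA]; split; first by rewrite !trmx_mul trmxK symA mulmxA.
move=> v v0; have := gtA (T *m v); rewrite trmx_mul !mulmxA; apply.
by apply: contra_neq v0 => /injT.
Qed.

Lemma posdef_unitmx n (A : 'M[K]_n) : posdef A -> A \in unitmx.
Proof.
move=> [_ gtA]; rewrite -row_free_unit -kermx_eq0; apply/rowV0P => v.
move=> /sub_kermxP vA0; apply: contraTeq isT => v0.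
have := gtA v^T; rewrite trmx_eq0 => /(_ v0).
by rewrite trmxK vA0 mul0mx mxE ltxx.
Qed.

(** The passivity matrix of a system without feedthrough has this form. *)
Lemma psd_block_diag0 n m (A : 'M[K]_n) :
  psd A -> psd (block_mx A 0 0 0 : 'M[K]_(n + m)).
Proof.
move=> /(psd_congr (row_mx 1%:M 0 : 'M[K]_(n, n + m))).
rewrite tr_row_mx trmx1 trmx0 mul_col_mx mul1mx mul0mx mul_col_mx.
by rewrite !mul_mx_row mulmx1 !mulmx0 mul0mx /block_mx.
Qed.

End Definite.

(** * Block matrices in three parts *)

Section Blocks.
Context (K : realType).

Lemma mul_block3_col3 a1 a2 a3 b1 b2 b3 c
    (A11 : 'M[K]_(a1, b1)) (A12 : 'M[K]_(a1, b2)) (A13 : 'M[K]_(a1, b3))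
    (A21 : 'M[K]_(a2, b1)) (A22 : 'M[K]_(a2, b2)) (A23 : 'M[K]_(a2, b3))
    (A31 : 'M[K]_(a3, b1)) (A32 : 'M[K]_(a3, b2)) (A33 : 'M[K]_(a3, b3))
    (B1 : 'M[K]_(b1, c)) (B2 : 'M[K]_(b2, c)) (B3 : 'M[K]_(b3, c)) :
  block3 A11 A12 A13 A21 A22 A23 A31 A32 A33 *m col3 B1 B2 B3 =
  col3 (A11 *m B1 + A12 *m B2 + A13 *m B3)
       (A21 *m B1 + A22 *m B2 + A23 *m B3)
       (A31 *m B1 + A32 *m B2 + A33 *m B3).
Proof.
by rewrite /block3 /col3 !(mul_block_col, mul_row_col, mul_col_mx) add_col_mx.
Qed.

Lemma mul_block3 a1 a2 a3 b1 b2 b3 c1 c2 c3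
    (A11 : 'M[K]_(a1, b1)) (A12 : 'M[K]_(a1, b2)) (A13 : 'M[K]_(a1, b3))
    (A21 : 'M[K]_(a2, b1)) (A22 : 'M[K]_(a2, b2)) (A23 : 'M[K]_(a2, b3))
    (A31 : 'M[K]_(a3, b1)) (A32 : 'M[K]_(a3, b2)) (A33 : 'M[K]_(a3, b3))
    (B11 : 'M[K]_(b1, c1)) (B12 : 'M[K]_(b1, c2)) (B13 : 'M[K]_(b1, c3))
    (B21 : 'M[K]_(b2, c1)) (B22 : 'M[K]_(b2, c2)) (B23 : 'M[K]_(b2, c3))
    (B31 : 'M[K]_(b3, c1)) (B32 : 'M[K]_(b3, c2)) (B33 : 'M[K]_(b3, c3)) :
  block3 A11 A12 A13 A21 A22 A23 A31 A32 A33 *m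
  block3 B11 B12 B13 B21 B22 B23 B31 B32 B33 =
  block3 (A11 *m B11 + A12 *m B21 + A13 *m B31)
         (A11 *m B12 + A12 *m B22 + A13 *m B32)
         (A11 *m B13 + A12 *m B23 + A13 *m B33)
         (A21 *m B11 + A22 *m B21 + A23 *m B31)
         (A21 *m B12 + A22 *m B22 + A23 *m B32)
         (A21 *m B13 + A22 *m B23 + A23 *m B33)
         (A31 *m B11 + A32 *m B21 + A33 *m B31)
         (A31 *m B12 + A32 *m B22 + A33 *m B32)
         (A31 *m B13 + A32 *m B23 + A33 *m B33).
Proof.
rewrite /block3 mulmx_block mulmx_block mul_col_row add_block_mx.
rewrite mul_block_col mul_col_mx add_col_mx.
by rewrite mul_row_block mul_mx_row add_row_mx mul_row_col.
Qed.

Lemma tr_block3 a1 a2 a3 b1 b2 b3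
    (A11 : 'M[K]_(a1, b1)) (A12 : 'M[K]_(a1, b2)) (A13 : 'M[K]_(a1, b3))
    (A21 : 'M[K]_(a2, b1)) (A22 : 'M[K]_(a2, b2)) (A23 : 'M[K]_(a2, b3))
    (A31 : 'M[K]_(a3, b1)) (A32 : 'M[K]_(a3, b2)) (A33 : 'M[K]_(a3, b3)) :
  (block3 A11 A12 A13 A21 A22 A23 A31 A32 A33)^T =
  block3 A11^T A21^T A31^T A12^T A22^T A32^T A13^T A23^T A33^T.
Proof. by rewrite /block3 !tr_block_mx tr_row_mx tr_col_mx. Qed.

Lemma block3_1 n1 n2 n3 :
  block3 1%:M 0 0 0 1%:M 0 0 0 1%:M = 1%:M :> 'M[K]_(n1 + n2 + n3).
Proof. by rewrite /block3 row_mx0 col_mx0 -!scalar_mx_block. Qed.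

Lemma mxsub_Qblk n1 n2 n3 (Q11 : 'M[K]_n1) (Q31 : 'M[K]_(n3, n1))
    (Q32 : 'M[K]_(n3, n2)) (Q33 : 'M[K]_n3) (Q := Qblk Q11 Q31 Q32 Q33) :
  [/\ mxsub i1 i1 Q = Q11, mxsub i3 i1 Q = Q31, mxsub i3 i2 Q = Q32
    & mxsub i3 i3 Q = Q33].
Proof.
by split; apply/matrixP => i j;
  rewrite mxE ?(block_mxEul, block_mxEdl, block_mxEdr) ?row_mxEl ?row_mxEr.
Qed.

Lemma rowsub_col3 n1 n2 n3 p
    (A1 : 'M[K]_(n1, p)) (A2 : 'M[K]_(n2, p)) (A3 : 'M[K]_(n3, p)) :
  [/\ rowsub i1 (col3 A1 A2 A3) = A1, rowsub i2 (col3 A1 A2 A3) = A2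
    & rowsub i3 (col3 A1 A2 A3) = A3].
Proof.
by split; apply/matrixP => i j; rewrite mxE ?col_mxEd // col_mxEu ?col_mxEu ?col_mxEd.
Qed.

Lemma col3_rowsub n1 n2 n3 p (A : 'M[K]_(n1 + n2 + n3, p)) :
  A = col3 (rowsub i1 A) (rowsub i2 A) (rowsub i3 A).
Proof.
apply/matrixP => i j; rewrite -[i]splitK.
case: (fintype.split i) => {}i /=; last first.
  by rewrite col_mxEd mxE.
by rewrite col_mxEu -[i]splitK; case: (fintype.split i) => {}i /=;
  rewrite ?col_mxEu ?col_mxEd mxE.
Qed.

Lemma vderiv_col3 n1 n2 n3 (x1 : K -> 'cV[K]_n1) (x2 : K -> 'cV[K]_n2)
    (x3 : K -> 'cV[K]_n3) t :
  vderiv (fun z => col3 (x1 z) (x2 z) (x3 z)) t =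
  col3 (vderiv x1 t) (vderiv x2 t) (vderiv x3 t).
Proof.
apply/matrixP => i j; rewrite mxE -[i]splitK.
case: (fintype.split i) => {}i /=; last first.
  by rewrite col_mxEd mxE; congr (derive1 _ t); apply/funext => z; rewrite col_mxEd.
rewrite col_mxEu -[i]splitK; case: (fintype.split i) => {}i /=;
  rewrite ?col_mxEu ?col_mxEd mxE; congr (derive1 _ t); apply/funext => z.
- by rewrite !col_mxEu.
- by rewrite col_mxEu col_mxEd.
Qed.

End Blocks.

(** * Change of state *)

Section Transform.
Context (K : realType) (n1 n2 n3 : nat).
Implicit Types (W : 'M[K]_n1).

Lemma Vblk_inv W : W \in unitmx ->
  Vblk n2 n3 W \in unitmx /\ invmx (Vblk n2 n3 W) = Vblk n2 n3 (invmx W).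
Proof.
move=> W_unit.
have VV' : Vblk n2 n3 W *m Vblk n2 n3 (invmx W) = 1%:M.
  rewrite mul_block3 !(mulmx0, mul0mx, mulmx1, addr0, add0r) mulmxV //.
  exact: block3_1.
have [V_unit _] := mulmx1_unit VV'; split=> //.
by rewrite -[RHS]mul1mx -(mulVmx V_unit) -mulmxA VV' mulmx1.
Qed.

Lemma transform_E W : W \in unitmx ->
  invmx (Vblk n2 n3 W) *m Eblk K n1 n2 n3 *m Vblk n2 n3 W = Eblk K n1 n2 n3.
Proof.
move=> W_unit; have [_ ->] := Vblk_inv W_unit.
by rewrite !mul_block3 !(mulmx0, mul0mx, mulmx1, addr0, add0r) mulVmx.
Qed.

Lemma transform_Q W (Q11 : 'M[K]_n1) (Q31 : 'M[K]_(n3, n1))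
    (Q32 : 'M[K]_(n3, n2)) (Q33 : 'M[K]_n3) :
  (Vblk n2 n3 W)^T *m Qblk Q11 Q31 Q32 Q33 *m Vblk n2 n3 W =
  Qblk (W^T *m Q11 *m W) (Q31 *m W) Q32 Q33.
Proof.
rewrite tr_block3 !mul_block3 !trmx0 !trmx1.
by rewrite !(mulmx0, mul0mx, mulmx1, mul1mx, addr0, add0r).
Qed.

End Transform.

(** * Effort constraint reduction *)

Section Reduction.
Context (K : realType) (r s n2 n3 : nat).
Local Notation N := (r + s + n2 + n3)%N.
Local Notation D := (delete_s K r s n2 n3).

Lemma delete_sE p (A : 'M[K]_(N, p)) :
  D *m A = col3 (rowsub ir A) (rowsub i2 A) (rowsub i3 A).
Proof.
rewrite {1}(col3_rowsub A) mul_block3_col3 !(mul0mx, mul1mx, addr0, add0r).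
congr col3; rewrite -[rowsub i1 A]vsubmxK mul_row_col mul1mx mul0mx addr0.
by apply/matrixP => i j; rewrite !mxE.
Qed.

Lemma mul_delete_sT p (A : 'M[K]_(p, N)) :
  A *m D^T = row_mx (row_mx (colsub ir A) (colsub i2 A)) (colsub i3 A).
Proof.
by rewrite -[A in LHS]trmxK -trmx_mul delete_sE !tr_col_mx !trmx_mxsub trmxK.
Qed.

Lemma ec_blockE (A : 'M[K]_N) : ec_block A = D *m A *m D^T.
Proof.
rewrite delete_sE /col3 2!mul_col_mx !mul_delete_sT -!mxsubcr.
by rewrite /ec_block /block3 block_mxEv [in LHS]block_mxEv -block_mxEh block_mxEv.
Qed.

Lemma ec_systemB m (Sg : phsys K N m) : mxB (ec_system Sg) = D *m mxB Sg.
Proof. by rewrite delete_sE. Qed.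

(** With [L := - Qss^-1 Qrs^T] the range of this embedding of the reduced state
    space is the set of states satisfying the effort constraint. *)
Definition constrain_s (L : 'M[K]_(s, r)) : 'M[K]_(N, r + n2 + n3) :=
  block3 (col_mx 1%:M L) 0    0
         0               1%:M 0
         0               0    1%:M.

Definition constraint_mx (Q : 'M[K]_N) : 'M[K]_(s, r) :=
  Qss_inv Q *m - (mxsub ir is_ Q)^T.

Lemma constrain_sE L (xr : 'cV[K]_r) (x2 : 'cV[K]_n2) (x3 : 'cV[K]_n3) :
  constrain_s L *m col3 xr x2 x3 = col3 (col_mx xr (L *m xr)) x2 x3.
Proof.
by rewrite mul_block3_col3 !(mul0mx, mul1mx, addr0, add0r) mul_col_mx mul1mx.
Qed.

(** With [mul_Q_constrain] this makes [Qec^T Eec] a congruence transform of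
    [Q^T E]. *)
Lemma delete_E_constrain L :
  D *m Eblk K (r + s) n2 n3 *m constrain_s L = Eblk K r n2 n3.
Proof.
rewrite !mul_block3 !(mulmx0, mul0mx, mulmx1, mul1mx, addr0, add0r).
by rewrite mul_row_col mul1mx mul0mx addr0.
Qed.

Lemma vderiv_Eblk (xr : K -> 'cV[K]_r) (x2 : K -> 'cV[K]_n2)
    (x3 : K -> 'cV[K]_n3) t :
  Eblk K r n2 n3 *m vderiv (fun z => col3 (xr z) (x2 z) (x3 z)) t =
  col3 (vderiv xr t) (vderiv x2 t) 0.
Proof.
by rewrite vderiv_col3 mul_block3_col3 !(mul0mx, mul1mx, addr0, add0r).
Qed.

Section SymmetricEffort.
Context (W : 'M[K]_(r + s)) (Q31 : 'M[K]_(n3, r + s)).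
Context (Q32 : 'M[K]_(n3, n2)) (Q33 : 'M[K]_n3).
Let Q : 'M[K]_N := Qblk W Q31 Q32 Q33.
Let T : 'M[K]_(N, r + n2 + n3) := constrain_s (constraint_mx Q).

Lemma Qblk_sub :
  [/\ mxsub ir ir Q = ulsubmx W, mxsub ir is_ Q = ursubmx W,
      mxsub is_ is_ Q = drsubmx W, mxsub i3 ir Q = lsubmx Q31
    & mxsub i3 is_ Q = rsubmx Q31].
Proof.
have [Q1 Q3 _ _] := mxsub_Qblk W Q31 Q32 Q33.
by rewrite -[X in ulsubmx X]Q1 -[X in ursubmx X]Q1 -[X in drsubmx X]Q1
  -[X in lsubmx X]Q3 -[X in rsubmx X]Q3; split; apply/matrixP => i j; rewrite !mxE.
Qed.

Hypothesis symW : W^T = W.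

Lemma dlsubmx_sym : dlsubmx W = (ursubmx W)^T.
Proof. by rewrite trmx_ursub symW. Qed.

Hypothesis Qss_unit : mxsub is_ is_ Q \in unitmx.

Lemma effort_s0P (xr : 'cV[K]_r) (xs : 'cV[K]_s) (x2 : 'cV[K]_n2)
    (x3 : 'cV[K]_n3) :
  rowsub is_ (Q *m col3 (col_mx xr xs) x2 x3) = 0 <->
  xs = constraint_mx Q *m xr.
Proof.
have [_ Qrs Qss _ _] := Qblk_sub.
have -> : rowsub is_ (Q *m col3 (col_mx xr xs) x2 x3) =
          (mxsub ir is_ Q)^T *m xr + mxsub is_ is_ Q *m xs.
  rewrite Qrs Qss mul_block3_col3 !(mul0mx, addr0).
  rewrite -[W in W *m _]submxK mul_block_col -dlsubmx_sym.
  by apply/matrixP => i j; rewrite mxE /col3 col_mxEu col_mxEu col_mxEd.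
rewrite /constraint_mx /Qss_inv -mulmxA mulNmx; split=> [/eqP | ->].
  by rewrite addrC addr_eq0 => /eqP /(canRL (mulKmx Qss_unit)).
by rewrite mulKVmx // subrr.
Qed.

(** The efforts of constrained states have no component in the block row [s],
    so nothing is lost in the reduced coefficient [Qec]. *)
Lemma mul_Q_constrain :
  Q *m T = D^T *m Qblk (Qhat11 Q) (Qhat31 Q) Q32 Q33.
Proof.
have [Qrr Qrs Qss Q3r Q3s] := Qblk_sub.
rewrite /T /constrain_s tr_block3 !mul_block3 !trmx0 !trmx1 tr_row_mx trmx1 trmx0.
rewrite !(mulmx0, mul0mx, mulmx1, mul1mx, addr0, add0r) mul_col_mx mul1mx mul0mx.
rewrite /Qhat11 /Qhat31 -!mulmxA -!mulmxN -/(constraint_mx Q).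
set L := constraint_mx Q.
have -> : Q31 *m col_mx 1%:M L = mxsub i3 ir Q + mxsub i3 is_ Q *m L.
  by rewrite Q3r Q3s -[Q31 in LHS]hsubmxK mul_row_col mulmx1.
have -> // : W *m col_mx 1%:M L =
             col_mx (mxsub ir ir Q + mxsub ir is_ Q *m L) 0.
rewrite -[W in LHS]submxK mul_block_col !mulmx1 Qrr Qrs dlsubmx_sym -Qrs -Qss.
by rewrite /L /constraint_mx /Qss_inv mulKVmx // subrr.
Qed.

End SymmetricEffort.

Section System.
Context (m : nat) (J R : 'M[K]_N) (B : 'M[K]_(N, m)).
Context (W : 'M[K]_(r + s)) (Q31 : 'M[K]_(n3, r + s)).
Context (Q32 : 'M[K]_(n3, n2)) (Q33 : 'M[K]_n3).
Let Q : 'M[K]_N := Qblk W Q31 Q32 Q33.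
Let Sg := phsys0 (Eblk K (r + s) n2 n3) J R Q B.
Hypothesis symW : W^T = W.
Hypothesis Qss_unit : mxsub is_ is_ Q \in unitmx.

Lemma ec_systemQ :
  mxQ (ec_system Sg) = Qblk (Qhat11 Q) (Qhat31 Q) Q32 Q33.
Proof.
by rewrite /=; have [_ _ -> ->] := mxsub_Qblk W Q31 Q32 Q33.
Qed.

Lemma effort_constrain :
  Q *m constrain_s (constraint_mx Q) = D^T *m mxQ (ec_system Sg).
Proof. by rewrite ec_systemQ; exact: mul_Q_constrain. Qed.

(** The effort constraint determines [x_s], and the port and constitutive
    relations determine the other eliminated variables except the [s]-block of
    the flow, which is free; the converse direction gives it the value [0]. *)
Lemma ecrm_atP l (C : 'M[K]_(N, l)) (Rhat : 'M[K]_l)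
    (xr : K -> 'cV[K]_r) (x2 : K -> 'cV[K]_n2) (x3 : K -> 'cV[K]_n3)
    (u y : K -> 'cV[K]_m) (t : K) :
  R = C *m Rhat *m C^T ->
  ecrm_at Sg C Rhat xr x2 x3 u y t <->
  phsys_at (ec_system Sg) (fun z => col3 (xr z) (x2 z) (x3 z)) u y t.
Proof.
move=> R_fact; rewrite /phsys_at ec_systemB vderiv_Eblk subr0 !addr0 mul0mx addr0.
set z := col3 (xr t) _ _; set Qec := mxQ (ec_system Sg).
have effortE : Q *m col3 (col_mx (xr t) (constraint_mx Q *m xr t)) (x2 t) (x3 t)
    = D^T *m Qec *m z.
  by rewrite -constrain_sE mulmxA effort_constrain.
have portE : D *m (J *m (D^T *m Qec *m z)
      + C *m - (Rhat *m (C^T *m (D^T *m Qec *m z))) + B *m u t)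
    = (ec_block J - ec_block R) *m Qec *m z + D *m B *m u t.
  rewrite !ec_blockE R_fact !mulmxBl !mulmxDr mulmxN mulmxN.
  by rewrite !mulmxA.
have outE : (D *m B)^T *m Qec *m z = B^T *m (D^T *m Qec *m z).
  by rewrite trmx_mul !mulmxA.
split.
- move=> [fx [ex [fR [eR [xs [[state out res] [es0 [fxr fx2 fx3 exE fRE]]]]]]]].
  have xsE : xs = constraint_mx Q *m xr t.
    by apply/(effort_s0P symW Qss_unit _ _ (x2 t) (x3 t)); rewrite -exE.
  rewrite xsE effortE in exE.
  have eRE : eR = C^T *m ex.
    by apply/eqP; rewrite -subr_eq0 addrC -res.
  split; last first.
    by rewrite outE -exE; apply/eqP; rewrite -subr_eq0 addrC -out.
  rewrite -portE -exE -eRE -fRE -state mulmxN delete_sE fxr fx2 fx3.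
  by rewrite !opp_col_mx !opprK oppr0.
- move=> [state out].
  exists (col3 (col_mx (- vderiv xr t) 0) (- vderiv x2 t) 0), (D^T *m Qec *m z),
    (- (Rhat *m (C^T *m (D^T *m Qec *m z)))), (C^T *m (D^T *m Qec *m z)),
    (constraint_mx Q *m xr t).
  set fx := col3 _ _ _.
  have [_ fx2 fx3] := rowsub_col3 (col_mx (- vderiv xr t) (0 : 'cV_s))
    (- vderiv x2 t) (0 : 'cV_n3).
  have fxr : rowsub ir fx = - vderiv xr t.
    by apply/matrixP => i j; rewrite mxE /fx /col3 !col_mxEu.
  split; first split.
  + rewrite portE -state mulmxN delete_sE fxr fx2 fx3.
    by rewrite !opp_col_mx !opprK oppr0.
  + by rewrite out outE addNr.
  + by rewrite addNr.
  split; last by split.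
  by rewrite -effortE; apply/(effort_s0P symW Qss_unit).
Qed.

(** The conditions on [Qec^T Jec Qec] and [Qec^T Rec Qec] follow from skewness
    and semidefiniteness of [Jec] and [Rec], which are principal submatrices of
    [J] and [R]; those on [Qec^T Eec] are inherited from [Q^T E] by congruence
    with the embedding of the constrained states. *)
Lemma is_pHDAE_ec :
  J^T = - J -> psd R -> psd (Q^T *m Eblk K (r + s) n2 n3) ->
  [/\ is_pHDAE (ec_system Sg), (mxJ (ec_system Sg))^T = - mxJ (ec_system Sg)
    & psd (mxR (ec_system Sg))].
Proof.
move=> skewJ psdR psdE; set Qec := mxQ (ec_system Sg).
have skewJec : (ec_block J)^T = - ec_block J.
  by rewrite ec_blockE !trmx_mul trmxK skewJ mulNmx mulmxN mulmxA.
have psdRec : psd (ec_block R).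
  by rewrite ec_blockE -[X in X *m R]trmxK; exact: psd_congr.
have psdEec : psd (Qec^T *m Eblk K r n2 n3).
  rewrite -(delete_E_constrain (constraint_mx Q)).
  have -> : Qec^T *m (D *m Eblk K (r + s) n2 n3 *m constrain_s (constraint_mx Q))
      = (D^T *m Qec)^T *m Eblk K (r + s) n2 n3 *m constrain_s (constraint_mx Q).
    by rewrite trmx_mul trmxK !mulmxA.
  rewrite -effort_constrain trmx_mul -(mulmxA _ Q^T).
  exact: psd_congr.
split=> //; split.
- by rewrite /= trmx0 oppr0.
- by rewrite /= skewJec mulmxN mulNmx.
- by have [<- _] := psdEec; rewrite trmx_mul trmxK.
- exact: psdEec.
- rewrite /passivity_mx /= trmx0 mulmx0 mul0mx.
  by apply: psd_block_diag0; exact: psd_congr.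
Qed.

End System.

End Reduction.

Theorem theorem3 (K : realType) (r s n2 n3 m l : nat)
    (J R : 'M[K]_(r + s + n2 + n3)) (B : 'M[K]_(r + s + n2 + n3, m))
    (Q11 : 'M[K]_(r + s)) (Q31 : 'M[K]_(n3, r + s))
    (Q32 : 'M[K]_(n3, n2)) (Q33 : 'M[K]_n3)
    (Vhat : 'M[K]_(r + s))
    (C : 'M[K]_(r + s + n2 + n3, l)) (Rhat : 'M[K]_l) :
  let Sg := phsys0 (Eblk K (r + s) n2 n3) J R (Qblk Q11 Q31 Q32 Q33) B in
  let Sgt := transform (Vblk n2 n3 Vhat) Sg in
  let Sgec := ec_system Sgt in
  (r < r + s)%N ->
  is_pHDAE Sg ->
  J^T = - J ->
  psd R ->
  mxsub i1 i3 J - mxsub i1 i3 R = 0 ->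
  mxsub i2 i3 J - mxsub i2 i3 R = 0 ->
  posdef Q11 ->
  Q33 \in unitmx ->
  Vhat \in unitmx ->
  mxR Sgt = C *m Rhat *m C^T ->
  posdef Rhat ->
  C^T *m C = 1%:M ->
  [/\ mxsub is_ is_ (mxQ Sgt) \in unitmx,
      forall (xr : K -> 'cV[K]_r) (x2 : K -> 'cV[K]_n2) (x3 : K -> 'cV[K]_n3)
             (u y : K -> 'cV[K]_m) (t : K),
        vderivable xr t -> vderivable x2 t -> vderivable x3 t ->
        (ecrm_at Sgt C Rhat xr x2 x3 u y t <->
         phsys_at Sgec (fun z => col3 (xr z) (x2 z) (x3 z)) u y t),
      is_pHDAE Sgec,
      (mxJ Sgec)^T = - mxJ Sgec
    & psd (mxR Sgec)].
Proof.
move=> Sg Sgt Sgec _ pH skewJ psdR _ _ pdQ11 _ V_unit R_fact _ _.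
pose V := Vblk n2 n3 Vhat.
pose W := Vhat^T *m Q11 *m Vhat; pose Qt := Qblk W (Q31 *m Vhat) Q32 Q33.
pose Jt := invmx V *m J *m (invmx V)^T; pose Rt := invmx V *m R *m (invmx V)^T.
have SgtE : Sgt = phsys0 (Eblk K (r + s) n2 n3) Jt Rt Qt (invmx V *m B).
  by rewrite /Sgt /transform /= transform_E // transform_Q.
have pdW : posdef W.
  by apply: posdef_congr pdQ11 => v /(canRL (mulKmx V_unit)); rewrite mulmx0.
have [symW _] := pdW.
have Qss_unit : mxsub is_ is_ Qt \in unitmx.
  have [_ _ -> _ _] := Qblk_sub W (Q31 *m Vhat) Q32 Q33.
  (* The block [Wss] is the congruence of [W] by the inclusion of the [s] part. *)
  have -> : drsubmx W = (col_mx 0 1%:M)^T *m W *m col_mx 0 1%:M.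
    rewrite tr_col_mx trmx0 trmx1 -[W in RHS]submxK mul_row_block mul_row_col.
    by rewrite !(mul0mx, mul1mx, mulmx0, mulmx1, add0r).
  apply: posdef_unitmx; apply: posdef_congr pdW => v.
  by rewrite mul_col_mx mul0mx mul1mx -[0 in RHS]col_mx0 => /eq_col_mx [].
have skewJt : Jt^T = - Jt by rewrite !trmx_mul trmxK skewJ mulNmx mulmxN mulmxA.
have psdRt : psd Rt by rewrite /Rt -[X in X *m R]trmxK; exact: psd_congr.
have psdQE : psd (Qt^T *m Eblk K (r + s) n2 n3).
  have [_ _ _ psdQE _] := pH.
  have -> : Qt^T *m Eblk K (r + s) n2 n3 = V^T *m (mxQ Sg)^T *m Defs.mxE Sg *m V.
    rewrite /Qt -transform_Q -(transform_E n2 n3 V_unit) !trmx_mul trmxK -/V.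
    have [V_unit' _] := Vblk_inv n2 n3 V_unit.
    by rewrite !mulmxA mulmxK.
  by rewrite -(mulmxA V^T); exact: psd_congr.
have [pHec skewJec psdRec] :=
  is_pHDAE_ec (invmx V *m B) symW Qss_unit skewJt psdRt psdQE.
rewrite /Sgec SgtE; rewrite SgtE /= in R_fact; split=> // xr x2 x3 u y t _ _ _.
exact: ecrm_atP.
Qed.
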